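(* Let $A_\pi=\gamma P_\pi$ and consider the recursion $\zeta_{k+1}=A_\pi\zeta_k$. Set $$\xi=1_n,\qquad \nu=\omega,\qquad G=\operatorname{diag}\left(\frac{\nu(1)}{\xi(1)},\ldots,\frac{\nu(n)}{\xi(n)}\right),$$ where $\omega$ is the stationary distribution of $P_\pi$. Then $$\xi>0 \ \text{ and }\ A_\pi\xi\le\gamma\xi,$$ $$\nu>0\ \text{ and }\ \nu^{T}A_\pi\le\gamma\nu^{T},$$ $$G\succ 0\ \text{ and }\ A_\pi^{T}GA_\pi\preceq\gamma^2G.$$ This leads to the following three types of Lyapunov functions $$V_1(\zeta)=\max_i|\zeta(i)|,\qquad V_2(\zeta)=|\nu^{T}\zeta|,\qquad V_3(\zeta)=\zeta^{T}G\zeta,$$ which satisfy $V_1(\zeta_k)\le C_1\gamma^k$, $V_2(\zeta_k)\le C_2\gamma^k$, and $V_3(\zeta_k)\le C_3\gamma^{2k}$ for some fixed positive constants $(C_1,C_2,C_3)$.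
   Context: Consider a Markov decision process with finite state set $\{1,\ldots,n\}$, finite action set, and discount factor $\gamma\in(0,1)$. For a given policy $\pi$, $P_\pi\in\mathbb{R}^{n\times n}$ is the probability transition matrix of the state process $\{s_k\}$ under $\pi$ (a right stochastic matrix: entrywise non-negative, each row summing to $1$), and $R_\pi\in\mathbb{R}^n$ is the vector of immediate rewards under $\pi$. The value function $J_\pi\in\mathbb{R}^n$ satisfies $J_\pi=R_\pi+\gamma P_\pi J_\pi$. Value computation is the iteration $J_{k+1}=\gamma P_\pi J_k+R_\pi$; with $\zeta_k=J_k-J_\pi\in\mathbb{R}^n$ it becomes the recursion $\zeta_{k+1}=A_\pi\zeta_k$. The stationary distribution $\omega\in\mathbb{R}^n$ of $P_\pi$ is a probability vector with $\omega^{T}P_\pi=\omega^{T}$. The vector $1_n\in\mathbb{R}^n$ has all entries equal to $1$. For $x\in\mathbb{R}^n$, $x(i)$ denotes its $i$-th entry. Vector inequalities ($>,\ge,\le$) are entrywise. $G\succ0$ means that $G$ is positive definite, and $A\preceq B$ means that $B-A$ is positive semidefinite.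
   Formalization: The claim ν>0 is proved when P_π is irreducible, and G≻0 whenever ν>0; as written both fail, e.g. for P_π=[[1,0],[1,0]], whose only stationary distribution is (1,0). All other claims hold for any stationary distribution. *)

(* Defs.v *)
From HB Require Import structures.
From mathcomp Require Import all_boot all_order all_algebra.

Set Implicit Arguments.
Unset Strict Implicit.
Unset Printing Implicit Defensive.

Import Order.TTheory GRing.Theory Num.Theory.
Local Open Scope ring_scope.

(* The scalars range over an arbitrary real field, of which                    *)
(* the real numbers are an instance; vectors of R^n are column matrices.       *)

Section MatrixOrders.
Variable R : realFieldType.

Definition mx_le m n (A B : 'M[R]_(m, n)) : Prop := forall i j, A i j <= B i j.
Definition mx_lt m n (A B : 'M[R]_(m, n)) : Prop := forall i j, A i j < B i j.

Definition quad_form n (M : 'M[R]_n) (x : 'cV[R]_n) : R :=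
  (x^T *m M *m x) ord0 ord0.

Definition posdefmx n (M : 'M[R]_n) : Prop :=
  M^T = M /\ forall x : 'cV[R]_n, x != 0 -> 0 < quad_form M x.

Definition possemidefmx n (M : 'M[R]_n) : Prop :=
  M^T = M /\ forall x : 'cV[R]_n, 0 <= quad_form M x.

Definition loewner_le n (A B : 'M[R]_n) : Prop := possemidefmx (B - A).

End MatrixOrders.

Section MarkovChains.
Variables (R : realFieldType) (n : nat).

Definition right_stochastic (P : 'M[R]_n) : Prop :=
  mx_le 0 P /\ forall i, \sum_j P i j = 1.

Definition probability_vector (w : 'cV[R]_n) : Prop :=
  mx_le 0 w /\ \sum_i w i ord0 = 1.

Definition stationary_distribution (P : 'M[R]_n) (w : 'cV[R]_n) : Prop :=
  probability_vector w /\ w^T *m P = w^T.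

(* For a stochastic P this says that every state is reachable from every state *)
(* (k = 0 only matters on the diagonal).                                       *)
Definition irreducible_chain (P : 'M[R]_n) : Prop :=
  forall i j, exists k : nat, 0 < (P ^+ k) i j.

End MarkovChains.

(* Under action a in state i, the next state is j with probability             *)
(* mdp_trans a i j, and that transition yields the reward mdp_reward a i j.    *)
Record mdp (R : realFieldType) (n : nat) := Mdp {
  mdp_action : finType;
  mdp_trans : mdp_action -> 'M[R]_n;
  mdp_reward : mdp_action -> 'M[R]_n;
  mdp_discount : R;
  mdp_trans_stochastic : forall a, right_stochastic (mdp_trans a);
  mdp_discount_gt0 : 0 < mdp_discount;
  mdp_discount_lt1 : mdp_discount < 1
}.

(* Stationary randomized policies; a deterministic policy is the case where    *)
(* every policy_prob pi i is a point mass.                                     *)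
Record policy (R : realFieldType) (n : nat) (M : mdp R n) := Policy {
  policy_prob : 'I_n -> mdp_action M -> R;
  policy_prob_ge0 : forall i a, 0 <= policy_prob i a;
  policy_prob_sum1 : forall i, \sum_a policy_prob i a = 1
}.

Definition policy_trans (R : realFieldType) (n : nat) (M : mdp R n)
    (pi : policy M) : 'M[R]_n :=
  \matrix_(i, j) \sum_a policy_prob pi i a * mdp_trans a i j.

Section Lyapunov.
Variables (R : realFieldType) (n : nat).

(* The default value 0 of the maximum is harmless, since it is a maximum of    *)
(* absolute values.                                                            *)
Definition V_max (x : 'cV[R]_n) : R := \big[Num.max/0]_i `|x i ord0|.

Definition V_lin (nu x : 'cV[R]_n) : R := `|(nu^T *m x) ord0 ord0|.

Definition V_quad (G : 'M[R]_n) (x : 'cV[R]_n) : R := quad_form G x.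

End Lyapunov.

(* Main.v *)
(** Everything follows from two facts about a stochastic [P] and a stationary
    [w]: averaging by the rows of [P] does not increase absolute values, and, by
    Jensen's inequality for the square, [sum_i w_i (P x)_i^2 <= sum_i w_i (P
    x^2)_i = sum_j w_j x_j^2].  Each function thus contracts by [gamma] (or
    [gamma ^ 2]) at each step.  A zero entry of [w] propagates to every state
    that reaches it, so irreducibility forces [w > 0]. *)
Require Import Defs.
From HB Require Import structures.
From mathcomp Require Import all_boot all_order all_algebra.
From mathcomp Require Import ring.

Set Implicit Arguments.
Unset Strict Implicit.
Unset Printing Implicit Defensive.

Import Order.TTheory GRing.Theory Num.Theory.
Local Open Scope ring_scope.

(** Each row is a convex combination, weighted by the policy, of rows of stochastic matrices. *)
Lemma policy_trans_stochastic (R : realFieldType) (n : nat) (M : mdp R n)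
  (pi : policy M) : right_stochastic (policy_trans pi).
Proof.
split=> [i j|i].
  rewrite !mxE sumr_ge0 // => a _; rewrite mulr_ge0 ?policy_prob_ge0 //.
  by have [/(_ i j)] := mdp_trans_stochastic a; rewrite mxE.
under eq_bigr => j _ do rewrite mxE.
rewrite exchange_big /= -(policy_prob_sum1 pi i); apply: eq_bigr => a _.
by rewrite -mulr_sumr; have [_ ->] := mdp_trans_stochastic a; rewrite mulr1.
Qed.

(** * Quadratic forms and the Loewner order *)

Lemma quad_form_diag (R : realFieldType) (n : nat) (d : 'rV[R]_n)
  (x : 'cV[R]_n) :
  quad_form (diag_mx d) x = \sum_i d ord0 i * x i ord0 ^+ 2.
Proof.
rewrite /quad_form -mulmxA mul_diag_mx mxE; apply: eq_bigr => i _.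
by rewrite !mxE; ring.
Qed.

Lemma quad_formB (R : realFieldType) (n : nat) (A B : 'M[R]_n) (x : 'cV[R]_n) :
  quad_form (A - B) x = quad_form A x - quad_form B x.
Proof. by rewrite /quad_form mulmxBr mulmxBl !mxE. Qed.

Lemma quad_formZ (R : realFieldType) (n : nat) (a : R) (A : 'M[R]_n)
  (x : 'cV[R]_n) : quad_form (a *: A) x = a * quad_form A x.
Proof. by rewrite /quad_form -scalemxAr -scalemxAl mxE. Qed.

Lemma quad_form_congr (R : realFieldType) (n : nat) (A G : 'M[R]_n)
  (x : 'cV[R]_n) : quad_form (A^T *m G *m A) x = quad_form G (A *m x).
Proof. by rewrite /quad_form trmx_mul !mulmxA. Qed.

Lemma quad_form_scalev (R : realFieldType) (n : nat) (a : R) (G : 'M[R]_n)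
  (x : 'cV[R]_n) : quad_form G (a *: x) = a ^+ 2 * quad_form G x.
Proof.
rewrite /quad_form [(a *: x)^T]linearZ /= -scalemxAr -!scalemxAl.
by rewrite !mxE mulrA.
Qed.

Lemma loewner_le_quad_form (R : realFieldType) (n : nat) (A B : 'M[R]_n)
  (x : 'cV[R]_n) : loewner_le A B -> quad_form A x <= quad_form B x.
Proof. by case=> _ /(_ x); rewrite quad_formB subr_ge0. Qed.

Lemma posdefmx_diag (R : realFieldType) (n : nat) (d : 'rV[R]_n) :
  (forall i, 0 < d ord0 i) -> posdefmx (diag_mx d).
Proof.
move=> d_gt0; split=> [|x]; first exact: tr_diag_mx.
(* Contrapositive: a sum of non-negative terms that is at most 0 vanishes term by term, and the
   positive weights then force every entry of [x] to be 0. *)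
apply: contraNT; rewrite quad_form_diag -leNgt => le0.
have ge0 i : true -> 0 <= d ord0 i * x i ord0 ^+ 2.
  by rewrite mulr_ge0 ?sqr_ge0 ?ltW.
have /eqP : \sum_i d ord0 i * x i ord0 ^+ 2 = 0.
  by apply/le_anti; rewrite le0 sumr_ge0.
rewrite psumr_eq0 // => /allP eq0.
apply/eqP/matrixP => i j; rewrite (ord1 j) mxE.
have := eq0 i (mem_index_enum i).
by rewrite mulf_eq0 gt_eqF //= expf_eq0 => /eqP.
Qed.

Lemma weighted_jensen_sqr (R : realFieldType) (I : finType) (p x : I -> R) :
  (forall i, 0 <= p i) -> \sum_i p i = 1 ->
  (\sum_i p i * x i) ^+ 2 <= \sum_i p i * x i ^+ 2.
Proof.
move=> p_ge0 p_sum1; set m := \sum_i p i * x i; rewrite -subr_ge0.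
(* The difference is the variance of [x] under [p]. *)
have <- : \sum_i p i * (x i - m) ^+ 2 = \sum_i p i * x i ^+ 2 - m ^+ 2.
  have E i : p i * (x i - m) ^+ 2 =
      p i * x i ^+ 2 - 2 * m * (p i * x i) + p i * m ^+ 2 by ring.
  under eq_bigr => i _ do rewrite E.
  by rewrite big_split sumrB /= -mulr_sumr -mulr_suml p_sum1 -/m; ring.
by rewrite sumr_ge0 // => i _; rewrite mulr_ge0 ?sqr_ge0.
Qed.

(** Turns a one-step contraction into the decay rates. The [+ 1] keeps the constant positive even
    when [f 0] is 0. *)
Lemma geometric_bound (R : realFieldType) (g : R) (f : nat -> R) :
  0 <= g -> (forall k, f k.+1 <= g * f k) ->
  forall k, f k <= (`|f 0| + 1) * g ^+ k.
Proof.
move=> g_ge0 fS; elim=> [|k IHk].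
  by rewrite expr0 mulr1 (le_trans (ler_norm _)) // lerDl.
by rewrite (le_trans (fS k)) // exprS mulrCA ler_wpM2l.
Qed.

(** * The maximum norm *)

Lemma ler_V_max (R : realFieldType) (n : nat) (x : 'cV[R]_n) i :
  `|x i ord0| <= V_max x.
Proof. by rewrite /V_max (bigD1 i) //= le_max lexx. Qed.

Lemma V_max_ge0 (R : realFieldType) (n : nat) (x : 'cV[R]_n) : 0 <= V_max x.
Proof.
rewrite /V_max; elim/big_ind: _ => // a b a_ge0 _.
by rewrite le_max a_ge0.
Qed.

Lemma V_max_le (R : realFieldType) (n : nat) (x : 'cV[R]_n) c :
  0 <= c -> (forall i, `|x i ord0| <= c) -> V_max x <= c.
Proof.
move=> c_ge0 x_le; rewrite /V_max; elim/big_ind: _ => // a b.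
by rewrite ge_max => -> ->.
Qed.

(** * Stochastic matrices and their stationary distributions *)

Section Stochastic.
Variables (R : realFieldType) (n : nat) (P : 'M[R]_n).
Hypothesis P_stoch : right_stochastic P.

Let P_ge0 i j : 0 <= P i j.
Proof. by have [/(_ i j)] := P_stoch; rewrite mxE. Qed.

Let P_sum1 i : \sum_j P i j = 1.
Proof. by have [] := P_stoch. Qed.

Lemma stochastic_mul1 : P *m const_mx 1 = const_mx 1 :> 'cV[R]_n.
Proof.
apply/matrixP => i j; rewrite !mxE -[RHS](P_sum1 i); apply: eq_bigr => k _.
by rewrite mxE mulr1.
Qed.

Lemma stochastic_exp_ge0 k i j : 0 <= (P ^+ k) i j.
Proof.
elim: k i j => [|k IHk] i j; first by rewrite expr0 mxE; case: (i == j).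
by rewrite exprS mxE sumr_ge0 // => l _; rewrite mulr_ge0.
Qed.

Lemma V_max_stochastic_scale (g : R) (x : 'cV[R]_n) :
  0 <= g -> V_max ((g *: P) *m x) <= g * V_max x.
Proof.
move=> g_ge0; apply: V_max_le => [|i]; first by rewrite mulr_ge0 ?V_max_ge0.
rewrite -scalemxAl mxE normrM ger0_norm // ler_wpM2l //.
rewrite mxE (le_trans (ler_norm_sum _ _ _)) //.
(* [V_max x] is spread over row [i] as the sum of [P i j * V_max x], so that the comparison is
   termwise. *)
rewrite -[leRHS]mul1r -(P_sum1 i) mulr_suml ler_sum // => j _.
by rewrite normrM ger0_norm // ler_wpM2l // ler_V_max.
Qed.

Variable w : 'cV[R]_n.
Hypothesis w_stat : stationary_distribution P w.

Let w_ge0 i : 0 <= w i ord0.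
Proof. by have [[/(_ i ord0)]] := w_stat; rewrite mxE. Qed.

Let w_sum1 : \sum_i w i ord0 = 1.
Proof. by have [[]] := w_stat. Qed.

Let wP : w^T *m P = w^T.
Proof. by have [] := w_stat. Qed.

Lemma stationary_exp k : w^T *m P ^+ k = w^T.
Proof.
elim: k => [|k IHk]; first by rewrite expr0 mulmx1.
by rewrite exprS mulmxA wP.
Qed.

(** If [w] vanishes at [j], entry [j] of [w^T *m P ^+ k = w^T] is a zero sum of non-negative terms.
    Choosing [k] with [(P ^+ k) i j] positive gives [w i ord0 = 0]; as [i] is arbitrary, the total
    mass would be 0 instead of 1. *)
Lemma stationary_gt0 : irreducible_chain P -> mx_lt 0 w.
Proof.
move=> irr j j0; rewrite (ord1 j0) mxE lt_neqAle w_ge0 andbT eq_sym.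
apply/eqP => wj0; have /eqP := oner_neq0 R; apply; rewrite -w_sum1.
apply: big1 => i _; have [k Pk_gt0] := irr i j.
have := stationary_exp k => /matrixP /(_ ord0 j); rewrite !mxE wj0.
move/eqP; rewrite psumr_eq0 => [|l _]; last first.
  by rewrite mxE mulr_ge0 // stochastic_exp_ge0.
move/allP => /(_ i (mem_index_enum i)).
by rewrite mxE mulf_eq0 (gt_eqF Pk_gt0) orbF => /eqP.
Qed.

Lemma quad_form_stationary_le (x : 'cV[R]_n) :
  quad_form (diag_mx w^T) (P *m x) <= quad_form (diag_mx w^T) x.
Proof.
rewrite !quad_form_diag.
(* Stationarity replaces each weight [w_j] by the sum of [w_i * P i j]; Jensen then applies to each
   row of [P] separately. *)
have -> : \sum_i w^T ord0 i * x i ord0 ^+ 2 =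
    \sum_i w^T ord0 i * \sum_j P i j * x j ord0 ^+ 2.
  rewrite -{1}wP; under eq_bigr => j _ do rewrite mxE mulr_suml.
  rewrite exchange_big /=; apply: eq_bigr => i _; rewrite mulr_sumr.
  by apply: eq_bigr => j _; rewrite mulrA.
apply: ler_sum => i _; rewrite !mxE ler_wpM2l //.
exact: weighted_jensen_sqr.
Qed.

Lemma loewner_le_stationary (g : R) :
  loewner_le ((g *: P)^T *m diag_mx w^T *m (g *: P)) (g ^+ 2 *: diag_mx w^T).
Proof.
split=> [|x].
  rewrite linearB /= linearZ /= !trmx_mul trmxK tr_diag_mx.
  by rewrite mulmxA.
rewrite quad_formB quad_formZ quad_form_congr -scalemxAl quad_form_scalev.
by rewrite -mulrBr mulr_ge0 ?sqr_ge0 // subr_ge0 quad_form_stationary_le.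
Qed.

Lemma V_lin_stationary_scale (g : R) (x : 'cV[R]_n) :
  0 <= g -> V_lin w ((g *: P) *m x) = g * V_lin w x.
Proof.
move=> g_ge0; rewrite /V_lin -scalemxAl -scalemxAr mulmxA wP mxE.
by rewrite normrM ger0_norm.
Qed.

End Stochastic.

(** A transient state has stationary weight 0, so positivity of [nu] is stated for irreducible
    chains, and definiteness of [G] is derived from that positivity. *)
Theorem theorem1 (R : realFieldType) (n : nat) (M : mdp R n) (pi : policy M)
    (omega : 'cV[R]_n)
    (homega : stationary_distribution (policy_trans pi) omega) :
  let gamma := mdp_discount M in
  let P := policy_trans pi in
  let A := gamma *: P in
  let xi : 'cV[R]_n := const_mx 1 in
  let nu := omega in
  let G := diag_mx (\row_(i < n) (nu i ord0 / xi i ord0)) in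
  [/\ mx_lt 0 xi /\ mx_le (A *m xi) (gamma *: xi),
      (irreducible_chain P -> mx_lt 0 nu) /\
        mx_le (nu^T *m A) (gamma *: nu^T),
      (mx_lt 0 nu -> posdefmx G) /\
        loewner_le (A^T *m G *m A) (gamma ^+ 2 *: G)
    & forall zeta : nat -> 'cV[R]_n,
        (forall k, zeta k.+1 = A *m zeta k) ->
        exists C1 C2 C3 : R,
          [/\ 0 < C1, 0 < C2, 0 < C3
            & forall k : nat,
                [/\ V_max (zeta k) <= C1 * gamma ^+ k,
                    V_lin nu (zeta k) <= C2 * gamma ^+ k
                  & V_quad G (zeta k) <= C3 * gamma ^+ (2 * k)]]].
Proof.
move=> gamma P A xi nu G.
have g_ge0 : 0 <= gamma by rewrite ltW ?mdp_discount_gt0.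
have Pst : right_stochastic P := policy_trans_stochastic pi.
have GE : G = diag_mx nu^T.
  by congr diag_mx; apply/matrixP => i j; rewrite !mxE divr1 (ord1 i).
have GA := loewner_le_stationary Pst homega gamma.
split.
- split=> [i j|i j]; first by rewrite !mxE.
  (* This inequality, like the one for [nu], holds with equality: [xi] and [nu] are right and left
     eigenvectors of [P] for the eigenvalue 1. *)
  by rewrite -scalemxAl stochastic_mul1.
- split=> [|i j]; first exact: stationary_gt0.
  by rewrite -scalemxAr; have [_ ->] := homega.
- rewrite GE; split=> // nu_gt0; apply: posdefmx_diag => i.
  by have := nu_gt0 i ord0; rewrite !mxE.
move=> zeta zetaS.
exists (`|V_max (zeta 0)| + 1), (`|V_lin nu (zeta 0)| + 1),
  (`|V_quad G (zeta 0)| + 1).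
split; [exact: ltr_wpDl | exact: ltr_wpDl | exact: ltr_wpDl |] => k.
split.
- apply: (geometric_bound (f := fun k => V_max (zeta k))) => // l.
  by rewrite /= zetaS V_max_stochastic_scale.
- apply: (geometric_bound (f := fun k => V_lin nu (zeta k))) => // l.
  by rewrite /= zetaS (V_lin_stationary_scale homega).
(* [gamma ^+ (2 * k)] is read as a [k]-th power of [gamma ^+ 2], the contraction ratio given by the
   Loewner inequality. *)
- rewrite exprM; apply: (geometric_bound (f := fun k => V_quad G (zeta k))) => [|l].
    exact: sqr_ge0.
  rewrite /= zetaS /V_quad -quad_form_congr -quad_formZ GE.
  exact: loewner_le_quad_form.
Qed.
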